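(* Let $p>2$ be a prime and $n\ge 2$. Let $G$ be the free $p$-group of class two and exponent $p$ on $n$ generators. Then $T(G)$ is cyclic of order $p-1$.
   Context: The free $p$-group of class two and exponent $p$ on $n$ generators is the relatively free group of rank $n$ in the variety of groups of nilpotence class at most $2$ and exponent dividing $p$. For a group $G$, $S(G)$ is the group of permutations of the set $G$. Let $\rho:G\to S(G)$, $\rho(g):h\mapsto hg$, be the right regular representation. Put $\operatorname{Hol}(G)=N_{S(G)}(\rho(G))=\operatorname{Aut}(G)\rho(G)$, $\operatorname{NHol}(G)=N_{S(G)}(\operatorname{Hol}(G))$ and $T(G)=\operatorname{NHol}(G)/\operatorname{Hol}(G)$. *)

(* Defs.v *)
From mathcomp Require Import all_boot all_fingroup all_solvable.

Set Implicit Arguments.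
Unset Strict Implicit.
Unset Printing Implicit Defensive.

Import GroupScope.

(* The variety of groups of nilpotence class at most 2 and exponent dividing p,
   given by its laws; members may be infinite. *)
Definition class2_exp_variety (p : nat) (H : groupType) : Prop :=
  (forall x y z : H, [~ x, y, z] = 1) /\ (forall x : H, x ^+ p = 1).

(* Relatively free groups of finite rank in this variety are finite (they are
   generated by n elements), so a finGroupType carrier loses no generality.
   Freeness is tested against every group of the variety, finite or not. *)
Definition relatively_free_on (p n : nat) (gT : finGroupType)
    (x : 'I_n -> gT) : Prop :=
  [/\ class2_exp_variety p gT,
      <<[set x i | i : 'I_n]>> = [set: gT]
    & forall (H : groupType) (y : 'I_n -> H), class2_exp_variety p H ->
        exists f : {multiplicative gT -> H}, forall i, f (x i) = y i].

Definition free_class2_exp (p n : nat) (gT : finGroupType) : Prop :=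
  exists x : 'I_n -> gT, relatively_free_on p x.

(* The action 'R is h |-> h * g, and the product of permutations s * t applies
   s first, so actperm 'R is the right regular representation, a morphism. *)
Definition right_regular (gT : finGroupType) : {group {perm gT}} :=
  (actperm 'R @* [set: gT])%G.

Definition Hol (gT : finGroupType) : {group {perm gT}} :=
  'N(right_regular gT)%G.

Definition NHol (gT : finGroupType) : {group {perm gT}} := 'N(Hol gT)%G.

Definition THol (gT : finGroupType) : {group coset_of (Hol gT)} :=
  (NHol gT / Hol gT)%G.

(* Main.v *)
Require Import Defs.
From mathcomp Require Import all_boot all_fingroup all_solvable.
From mathcomp Require Import ssralg finalg zmodp.

(** Write R(g) for the right translation by g.  The power map
    P_u : h |-> h^u, for u invertible modulo p, commutes with every
    automorphism, and in class two it conjugates R(g) to the product of an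
    inner automorphism and R(g^u); hence P_u normalizes Hol(G).  It lies in
    Hol(G) only when it is an automorphism, that is when u = 1, since
    (hg)^u = h^u g^u [g, h]^(u(u-1)/2) and G is not abelian.  So the units
    modulo p embed in T(G), and the whole point is that they fill it
    ([NHol_power_morph], [THol_cyclic_card]).

    Let t in NHol(G) fix 1.  The conjugate R(G)^t is a regular normal subgroup
    of Hol(G); its element sending 1 to g has the form gamma(g) R(g) with
    gamma(g) an automorphism, and normality makes gamma equivariant:
    gamma(g^b) = gamma(g)^b for every automorphism b ([twisted_translations]).
    In particular gamma(x_i), for a free generator x_i, commutes with all the
    automorphisms fixing x_i.  A free group has many of these.  Those squaring
    another generator x_k show on which generators the images gamma(x_i) and
    gamma(x_j) depend, leaving
      gamma(x_i) = x_i^d   and   gamma(x_j) = x_j^q [x_j, x_i]^m,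
    and conjugation by x_i together with the transvection x_j |-> x_j x_i
    force d = q = 1 modulo p.  So gamma(x_i) is the conjugation by x_i^m, with
    the same m for all j since generators can be swapped
    ([equivariant_inner]).  The elements g for which gamma(g) is the
    conjugation by g^m are stable under automorphisms and under the twisted
    product (g, h) |-> g h [g, h]^m, and these two facts make them a subgroup
    ([equivariant_family_inner]).  Therefore
      t(gh) = t(g) t(h) [t(g), t(h)]^m.
    Raising to the power 2m+1 cancels the commutator, because
    (2m+1)(2m)/2 = m(2m+1); and 2m+1 is prime to p, for otherwise this twisted
    product would be commutative and G abelian.  So t followed by
    P_(2m+1) is an automorphism, and t is a power map modulo Hol(G). *)

Set Implicit Arguments.
Unset Strict Implicit.
Unset Printing Implicit Defensive.

Import GroupScope.

Set Bullet Behavior "Strict Subproofs".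

(** * Multiplicative self-maps *)

Section EndomorphismLaws.

Variables (gT : finGroupType) (f : gT -> gT).
Hypothesis fM : {morph f : x y / x * y}.

Lemma endo1 : f 1 = 1.
Proof. by apply: (mulIg (f 1)); rewrite -fM !mul1g. Qed.

Lemma endoV : {morph f : x / x^-1}.
Proof. by move=> x; apply: (mulIg (f x)); rewrite -fM !mulVg endo1. Qed.

Lemma endoX k : {morph f : x / x ^+ k}.
Proof. by move=> x; elim: k => [|k IHk]; rewrite ?endo1 // !expgS fM IHk. Qed.

Lemma endoR : {morph f : x y / [~ x, y]}.
Proof. by move=> x y; rewrite !fM !endoV. Qed.

Lemma endoJ : {morph f : x y / x ^ y}.
Proof. by move=> x y; rewrite !fM !endoV. Qed.

End EndomorphismLaws.

(** * The holomorph and its normalizer *)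

Section Holomorph.

Variable gT : finGroupType.
Implicit Types (g h x y : gT) (s t : {perm gT}).

Local Notation rtrans := (actperm 'R).

Lemma rtransE g x : rtrans g x = x * g.
Proof. by rewrite actpermE. Qed.

Lemma rtransM g h : rtrans (g * h) = rtrans g * rtrans h.
Proof. by apply/permP=> x; rewrite permM !rtransE mulgA. Qed.

Lemma mem_right_regular g : rtrans g \in right_regular gT.
Proof. by rewrite mem_morphim // inE. Qed.

Lemma right_regularP s :
  reflect (exists g, s = rtrans g) (s \in right_regular gT).
Proof.
apply: (iffP morphimP) => [[g _ _ ->] | [g ->]]; first by exists g.
by exists g; rewrite ?inE.
Qed.

Lemma rtrans_Hol g : rtrans g \in Hol gT.
Proof. exact: (subsetP (normG _)) (mem_right_regular g). Qed.

Lemma rtransJ s g : {morph s : x y / x * y} -> rtrans g ^ s = rtrans (s g).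
Proof.
move=> sM; apply/permP=> x.
by rewrite -{1}(permKV s x) permJ !rtransE sM permKV.
Qed.

Lemma morph_Hol s : {morph s : x y / x * y} -> s \in Hol gT.
Proof.
move=> sM; rewrite inE; apply/subsetP=> _ /imsetP[r /right_regularP[g ->] ->].
by rewrite rtransJ // mem_right_regular.
Qed.

(** If s normalizes the right translations then s(xy) = s(x) z with z depending
    on y alone, and x = 1 identifies z as s(y): this is the decomposition
    Hol(G) = Aut(G) R(G), read on the stabilizer of 1. *)
Lemma Hol_morph s : s \in Hol gT -> s 1 = 1 -> {morph s : x y / x * y}.
Proof.
move=> sH s1.
have key y : exists z, forall x, s (x * y) = s x * z.
  have: rtrans y ^ s \in right_regular gT.
    by rewrite memJ_norm // mem_right_regular.
  case/right_regularP=> z Dz; exists z => x.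
  by rewrite -[RHS]rtransE -Dz permJ rtransE.
move=> x y; have [z Dz] := key y.
by rewrite Dz -[y in RHS]mul1g Dz s1 mul1g.
Qed.

Lemma Hol_split s : s \in Hol gT -> {morph s * rtrans (s 1)^-1 : x y / x * y}.
Proof.
move=> sH; apply: Hol_morph; first by rewrite groupM ?rtrans_Hol.
by rewrite permM rtransE mulgV.
Qed.

(** The translations of G conjugated by t still form a regular subgroup of
    Hol(G), so each has the form gamma(g) R(g); they describe the group law that
    t transports to G, namely x o g = gamma(g)(x) g.  Equivariance of gamma
    holds because conjugating an automorphism b by t^-1 gives an element of the
    stabilizer of 1 in Hol(G), again an automorphism, so that b permutes the
    conjugated translations.  The third clause says that gamma is a homomorphism
    for o. *)
Lemma twisted_translations t : t \in NHol gT -> t 1 = 1 ->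
  exists gamma : gT -> {perm gT},
  [/\ forall g, {morph gamma g : x y / x * y},
      forall (b : {perm gT}) g, {morph b : x y / x * y} ->
        gamma (b g) = gamma g ^ b,
      forall g h, gamma (gamma h g * h) = gamma g * gamma h
    & forall x y, t (x * y) = gamma (t y) (t x) * t y].
Proof.
move=> tN t1; pose nu g := rtrans (t^-1 g) ^ t.
have tV1 : t^-1 1 = 1 by rewrite -{1}t1 permK.
have nuE g x : nu g x = t (t^-1 x * t^-1 g).
  by rewrite /nu -{1}(permKV t x) permJ rtransE.
have nu1 g : nu g 1 = g by rewrite nuE tV1 mul1g permKV.
have nuH g : nu g \in Hol gT by rewrite memJ_norm ?rtrans_Hol.
(* nu g is the element of the conjugated regular group sending 1 to g. *)
pose gamma g := nu g * rtrans g^-1.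
have gE g x : gamma g x = nu g x * g^-1 by rewrite permM rtransE.
have gM g : {morph gamma g : x y / x * y}.
  by rewrite /gamma -{2}[g]nu1; apply: Hol_split.
exists gamma; split=> // [b g bM | g h | x y].
- have cM : {morph b ^ t^-1 : x y / x * y}.
    apply: Hol_morph; first by rewrite memJ_norm ?groupV // morph_Hol.
    by rewrite -[in LHS]tV1 permJ endo1.
  rewrite /gamma conjMg rtransJ // endoV //.
  congr (_ * _); rewrite /nu -conjgM [t * b]conjgCV conjgM (rtransJ _ cM).
  by rewrite permJ.
- apply/permP=> x; rewrite [RHS]permM.
  have -> : gamma h g * h = nu h g by rewrite gE mulgKV.
  have nuM : nu (nu h g) x = nu h (nu g x) by rewrite !nuE !permK mulgA.
  rewrite [gamma g x]gE gM (endoV (gM h)) !gE nuM.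
  by rewrite invMg invgK mulgA mulgKV.
- by rewrite gE mulgKV nuE !permK.
Qed.

End Holomorph.

(** * Commutator calculus in class two *)

Lemma commute_mulgACA (gT : finGroupType) (a b c d : gT) :
  commute b c -> a * b * (c * d) = a * c * (b * d).
Proof. by move=> bc; rewrite mulgA -(mulgA a b) bc !mulgA. Qed.

Section ClassTwo.

Variable gT : finGroupType.
Hypothesis class2 : forall x y z : gT, [~ x, y, z] = 1.
Implicit Types x y z g h : gT.

Lemma commg_central x y z : commute z [~ x, y].
Proof. exact/commute_sym/commgP/eqP/class2. Qed.

Lemma conjg_comm x y z : [~ x, y] ^ z = [~ x, y].
Proof. by apply/conjg_fixP; rewrite class2. Qed.

Lemma commgMl x y z : [~ x * y, z] = [~ x, z] * [~ y, z].
Proof. by rewrite commMgJ conjg_comm. Qed.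

Lemma commgMr x y z : [~ x, y * z] = [~ x, y] * [~ x, z].
Proof. by rewrite commgMJ conjg_comm commg_central. Qed.

Lemma commXl k x y : [~ x ^+ k, y] = [~ x, y] ^+ k.
Proof. exact/commXg/commg_central. Qed.

Lemma commXr k x y : [~ x, y ^+ k] = [~ x, y] ^+ k.
Proof. exact/commgX/commg_central. Qed.

Lemma commRr x y z : [~ z, [~ x, y]] = 1.
Proof. exact/eqP/commgP/commg_central. Qed.

Lemma expMg_class2 k x y :
  (x * y) ^+ k = x ^+ k * y ^+ k * [~ y, x] ^+ 'C(k, 2).
Proof. by apply: expMg_Rmul; apply: commg_central. Qed.

Lemma conjgX_class2 k x y : x ^ (y ^+ k) = x * [~ x, y] ^+ k.
Proof. by rewrite conjg_mulR commXr. Qed.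

End ClassTwo.

(** * Power maps in the multiple holomorph *)

Section PowerMaps.

Variables (p : nat) (gT : finGroupType).
Hypotheses (p_pr : prime p) (varG : class2_exp_variety p gT).
Implicit Types (x y g h : gT) (u v : {unit 'Z_p}).

Let class2 : forall x y z : gT, [~ x, y, z] = 1 := varG.1.
Let exp_p x : x ^+ p = 1. Proof. exact: varG.2. Qed.

Lemma expg_modp x k : x ^+ (k %% p) = x ^+ k.
Proof. exact: expg_mod. Qed.

Lemma order_exp_p x : x != 1 -> #[x] = p.
Proof. exact: nt_prime_order. Qed.

Lemma expgZpM x u v : x ^+ val (u * v) = x ^+ val u ^+ val v.
Proof.
by rewrite -expgM -[RHS]expg_modp -[p in _ %% p](Zp_cast (prime_gt1 p_pr)).
Qed.

Lemma expgZp1 x : x ^+ val (1 : {unit 'Z_p}) = x.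
Proof. by rewrite /= modn_small // Zp_cast ?prime_gt1. Qed.

Lemma power_inj u : injective (fun x => x ^+ val u).
Proof.
apply: (can_inj (g := fun x => x ^+ val u^-1)) => x.
by rewrite -expgZpM mulgV expgZp1.
Qed.

Definition power_perm u : {perm gT} := perm (@power_inj u).

Lemma power_permE u x : power_perm u x = x ^+ val u.
Proof. exact: permE. Qed.

Lemma power_permM : {morph power_perm : u v / u * v}.
Proof. by move=> u v; apply/permP=> x; rewrite permM !power_permE expgZpM. Qed.

Lemma power_permV u : (power_perm u)^-1 = power_perm u^-1.
Proof.
apply/eqP; rewrite eq_sym -mulg_eq1 -power_permM mulVg.
by apply/eqP/permP=> x; rewrite power_permE perm1 expgZp1.
Qed.

(** Modulo automorphisms, which commute with power maps, only translations
    matter.  With x = y^u, the conjugate of R(g) sends x to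
    (y g)^u = y^u g^u [g, y]^C(u,2), and the commutator is absorbed by an inner
    automorphism applied to x. *)
Lemma power_perm_NHol u : power_perm u \in NHol gT.
Proof.
rewrite inE; apply/subsetP=> _ /imsetP[s sH ->].
set P := power_perm u.
have aM := Hol_split sH; set a := s * _ in aM.
have -> : s = a * actperm 'R (s 1).
  by rewrite -mulgA -rtransM mulVg (_ : actperm 'R 1 = 1) ?mulg1 // morph1.
move: (s 1) => g; rewrite conjMg groupM //.
  suff -> : a ^ P = a by apply: morph_Hol.
  apply/permP=> x; rewrite -{1}(permKV P x) permJ !power_permE -endoX //.
  by rewrite -(power_permE u) permKV.
(* The factor u^-1 compensates for [g, x] = [g, y]^u. *)
pose h := g ^- ('C(val u, 2) * val u^-1).
have -> : actperm 'R g ^ P = perm (conjg_inj h) * actperm 'R (g ^+ val u).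
  apply/permP=> x; rewrite -{1}(permKV P x) permJ permM !rtransE permE.
  rewrite power_permV !power_permE expMg_class2 //.
  rewrite -[x in RHS]expgZp1 -(mulVg u) expgZpM.
  move: (x ^+ _) => y; rewrite conjg_mulR /h commgV; last exact: commg_central.
  rewrite invgR commXl // commXr // mulnC expgM -expgZpM mulgV expgZp1.
  by rewrite -!mulgA; congr (_ * _); apply/commuteX/commg_central.
by rewrite groupM ?rtrans_Hol ?morph_Hol // => x y; rewrite !permE conjMg.
Qed.

Lemma power_perm_Hol x y u :
  [~ x, y] != 1 -> power_perm u \in Hol gT -> u = 1.
Proof.
move=> ntxy /Hol_morph uH; have {uH}uM := uH _.
have /uM{uM} : power_perm u 1 = 1 by rewrite power_permE expg1n.
move/(_ y x); rewrite !power_permE expMg_class2 // => /eqP.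
rewrite -[X in _ == X]mulg1 (inj_eq (mulgI _)) -order_dvdn order_exp_p //.
move=> p_dv_bin.
(* What remains is arithmetic: p divides u(u-1)/2 and 0 < u < p. *)
have p_ndv_u : ~~ (p %| val u).
  apply: contra ntxy => p_dv_u; rewrite -[X in X == _]expgZp1 -(mulgV u).
  by rewrite expgZpM -(expg_modp _ (val u)) (eqP p_dv_u) expg1n.
have: p %| val u * (val u).-1.
  by rewrite -[(val u).-1]bin1 mul_bin_diag dvdn_mull.
rewrite Euclid_dvdM // (negPf p_ndv_u) /= => p_dv_u1.
have u_gt0 : 0 < val u by rewrite lt0n; apply: contra p_ndv_u => /eqP->.
have lt_u_p : val u < p by rewrite -[p in _ < p](Zp_cast (prime_gt1 p_pr)).
do 2!apply: val_inj => /=; rewrite -(prednK u_gt0); congr _.+1.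
apply/eqP; rewrite -leqn0 leqNgt; apply: contraL p_dv_u1 => u1.
by rewrite gtnNdvd // prednK // ltnW.
Qed.

(** The power maps identify T(G) with the cyclic group of units modulo p, once
    they are known to represent all the cosets.  Translating lets every coset be
    represented by a permutation fixing 1. *)
Lemma THol_cyclic_card x y : [~ x, y] != 1 ->
    (forall t, t \in NHol gT -> t 1 = 1 ->
       exists u : {unit 'Z_p}, {morph (fun g => t g ^+ val u) : g h / g * h}) ->
  cyclic (THol gT) /\ #|THol gT| = p.-1.
Proof.
move=> ntxy NHol_power.
have fM : {in units_Zp p &, {morph (fun u => coset (Hol gT) (power_perm u)) :
              u v / u * v}}.
  by move=> u v _ _; rewrite power_permM morphM ?power_perm_NHol.
pose f := Morphism fM.
have injf : 'injm f.
  apply/subsetP=> u /morphpreP[_ /set1P/coset_idr uH]; apply/set1P.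
  exact: (power_perm_Hol ntxy (uH (power_perm_NHol u))).
have imf : f @* units_Zp p = THol gT.
  apply/eqP; rewrite eqEsubset; apply/andP; split; apply/subsetP.
    move=> _ /morphimP[u _ _ ->].
    by apply: mem_quotient; apply: power_perm_NHol.
  move=> _ /morphimP[s sN _ ->] /=.
  pose t := s * actperm 'R (s 1)^-1.
  have tN : t \in NHol gT.
    by rewrite groupM // (subsetP (normG _)) // rtrans_Hol.
  have t1 : t 1 = 1 by rewrite permM rtransE mulgV.
  have [u tuM] := NHol_power t tN t1.
  have tuH : t * power_perm u \in Hol gT.
    by apply: morph_Hol => g h; rewrite !(permM t) !power_permE; apply: tuM.
  have Ds : s = t * power_perm u * (power_perm u^-1 * actperm 'R (s 1)).
    rewrite -power_permV mulgA mulgK -mulgA -rtransM mulVg.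
    by rewrite (_ : actperm 'R 1 = 1) ?mulg1 // morph1.
  have RN : actperm 'R (s 1) \in NHol gT.
    by rewrite (subsetP (normG _)) ?rtrans_Hol.
  suff -> : coset (Hol gT) s = f u^-1 by rewrite mem_morphim ?inE.
  have PN := power_perm_NHol u^-1.
  have tPN : t * power_perm u \in NHol gT by rewrite groupM ?power_perm_NHol.
  rewrite Ds morphM ?(groupM PN) // (morphM _ PN RN).
  by rewrite /= (coset_id tuH) (coset_id (rtrans_Hol _)) mul1g mulg1.
rewrite -imf; split.
  by rewrite injm_cyclic ?units_Zp_cyclic.
by rewrite card_injm // card_units_Zp ?prime_gt0 // totient_prime.
Qed.

End PowerMaps.

(** * Automorphisms of the free group and what commutes with them *)

Section FreeGroup.

Variables (p n : nat) (gT : finGroupType) (x : 'I_n -> gT).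
Hypotheses (p_pr : prime p) (p_gt2 : 2 < p) (freeG : relatively_free_on p x).
Implicit Types (a b g h w : gT) (i j : 'I_n).

Let varG : class2_exp_variety p gT. Proof. by case: freeG. Qed.
Let class2 : forall a b c : gT, [~ a, b, c] = 1 := varG.1.
Let exp_p a : a ^+ p = 1. Proof. exact: varG.2. Qed.

Lemma free_ind (P : gT -> Prop) :
    P 1 -> (forall i, P (x i)) -> (forall a b, P a -> P b -> P (a * b)) ->
  forall a, P a.
Proof.
move=> P1 Px PM a; have [_ genG _] := freeG.
have: a \in <<[set x i | i : 'I_n]>> by rewrite genG inE.
case/gen_prodgP=> m [c xc ->].
by apply: big_ind => // k _; have /imsetP[i _ ->] := xc k.
Qed.

Lemma extend (y : 'I_n -> gT) :
  exists2 f : gT -> gT, {morph f : a b / a * b} & forall i, f (x i) = y i.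
Proof.
have [_ _ /(_ _ y varG)[f fx]] := freeG.
by exists f => //; apply: gmulfM.
Qed.

Lemma endo_ext (f g : gT -> gT) :
    {morph f : a b / a * b} -> {morph g : a b / a * b} ->
  (forall i, f (x i) = g (x i)) -> f =1 g.
Proof.
move=> fM gM fgx; apply: free_ind => [|//|a b fga fgb]; first by rewrite !endo1.
by rewrite fM gM fga fgb.
Qed.

(** An endomorphism given on the generators is invertible once some endomorphism
    undoes it on the generators. *)
Lemma extend_perm (y z : 'I_n -> gT) :
    (forall f : gT -> gT, {morph f : a b / a * b} ->
       (forall i, f (x i) = z i) -> forall i, f (y i) = x i) ->
  exists2 s : {perm gT}, {morph s : a b / a * b} & forall i, s (x i) = y i.
Proof.
move=> yzK; have [f fM fx] := extend y; have [g gM gx] := extend z.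
have fK : cancel f g.
  apply: endo_ext => [a b||i] //=; first by rewrite fM gM.
  by rewrite fx yzK.
by exists (perm (can_inj fK)) => [a b | i]; rewrite !permE.
Qed.

Lemma square_perm j : exists2 s : {perm gT}, {morph s : a b / a * b} &
  forall i, s (x i) = if i == j then x i ^+ 2 else x i.
Proof.
(* (p+1)/2 is the inverse of 2 modulo p. *)
apply: (@extend_perm _ (fun i => if i == j then x i ^+ p.+1./2 else x i)).
move=> f fM fx i; case: ifP => ij; last by rewrite fx ij.
rewrite endoX // fx ij -expgM muln2 even_halfK.
  by rewrite expgS exp_p mulg1.
by rewrite /= negbK; case: (even_prime p_pr) p_gt2 => [->|].
Qed.

Lemma transvection_perm i j : i != j ->
  exists2 s : {perm gT}, {morph s : a b / a * b} &
  forall k, s (x k) = if k == j then x j * x i else x k.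
Proof.
move=> ij.
apply: (@extend_perm _ (fun k => if k == j then x j * (x i)^-1 else x k)).
move=> f fM fx k; case: eqP => [->|/eqP/negPf kj]; last by rewrite fx kj.
by rewrite fM !fx eqxx (negPf ij) mulgVK.
Qed.

Lemma swap_perm i j : exists2 s : {perm gT}, {morph s : a b / a * b} &
  forall k, s (x k) = x (tperm i j k).
Proof.
apply: (@extend_perm _ (fun k => x (tperm i j k))) => f fM fx k.
by rewrite fx tpermK.
Qed.

Lemma square_kill j (s e : gT -> gT) :
    {morph s : a b / a * b} ->
    (forall i, s (x i) = if i == j then x i ^+ 2 else x i) ->
    {morph e : a b / a * b} ->
    (forall i, e (x i) = if i == j then 1 else x i) ->
  forall a, s (e a) = e a.
Proof.
move=> sM sx eM ex; apply: (@endo_ext (s \o e) e) => [a b|//|i] /=.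
  by rewrite eM sM.
by rewrite ex; case: ifP => ij; rewrite ?endo1 // sx ij.
Qed.

(** The normal closure of x_j, onto which a |-> e(a)^-1 a maps, consists of the
    elements x_j^k [x_j, g] with g a product of other generators; in class two
    these have degree one in x_j, hence squaring x_j squares them. *)
Lemma square_perm_ker j (s : {perm gT}) (e : gT -> gT) :
    {morph s : a b / a * b} ->
    (forall i, s (x i) = if i == j then x i ^+ 2 else x i) ->
    {morph e : a b / a * b} ->
    (forall i, e (x i) = if i == j then 1 else x i) ->
  forall a, s ((e a)^-1 * a) = ((e a)^-1 * a) ^+ 2.
Proof.
move=> sM sx eM ex a.
have se := square_kill sM sx eM ex.
have [k [g [sg ->]]] : exists k, exists g,
    s g = g /\ (e a)^-1 * a = x j ^+ k * [~ x j, g].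
  { elim/free_ind: a => [|i|a b [k [g [sg Da]]] [l [h [sh Db]]]].
  - by exists 0, 1; rewrite (endo1 sM) (endo1 eM) !(commg1, invg1, mulg1).
  - rewrite ex; case: ifP => [/eqP-> | ij].
      by exists 1%N, 1; rewrite (endo1 sM) commg1 invg1 mul1g mulg1.
    by exists 0, 1; rewrite (endo1 sM) commg1 mulVg mulg1.
  - exists (k + l)%N, (e b ^+ k * g * h).
    rewrite !sM endoX // se sg sh; split=> //.
    have -> : (e (a * b))^-1 * (a * b) = ((e a)^-1 * a) ^ e b * ((e b)^-1 * b).
      by rewrite eM invMg conjgE !mulgA mulgK.
    (* e(b)^k accounts for moving x_j^k past e(b). *)
    rewrite Da Db conjMg conjg_comm // conjg_mulR commXl // -commXr //.
    rewrite -(mulgA (x j ^+ k)) -commgMr //.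
    rewrite (commute_mulgACA _ _ (commute_sym _)); last exact: commg_central.
    by rewrite -commgMr // expgD. }
rewrite sM endoX // endoR // sg sx eqxx commXl //.
rewrite [RHS]expgMn; last exact: commg_central.
by rewrite -!expgM mulnC.
Qed.

(** The part of w involving x_j is squared by the automorphism squaring x_j, so
    it is trivial if that automorphism fixes w. *)
Lemma fixed_by_square j w :
    (forall s : {perm gT}, {morph s : a b / a * b} ->
      (forall i, s (x i) = if i == j then x i ^+ 2 else x i) -> s w = w) ->
  forall e : gT -> gT, {morph e : a b / a * b} ->
    (forall i, e (x i) = if i == j then 1 else x i) -> e w = w.
Proof.
move=> sw e eM ex; have [s sM sx] := square_perm j.
have := square_perm_ker sM sx eM ex w.
rewrite sM endoV // (square_kill sM sx eM ex) sw //.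
rewrite expgS expg1 -[LHS]mulg1 => /mulgI/esym/mulg1_eq.
by rewrite invgK.
Qed.

(** Dually, the part of w not involving x_j is fixed by the automorphism that
    squares x_j, so it is trivial if that automorphism squares w. *)
Lemma squared_by_square j w :
    (forall s : {perm gT}, {morph s : a b / a * b} ->
      (forall i, s (x i) = if i == j then x i ^+ 2 else x i) -> s w = w ^+ 2) ->
  forall e : gT -> gT, {morph e : a b / a * b} ->
    (forall i, e (x i) = if i == j then 1 else x i) -> e w = 1.
Proof.
move=> sw e eM ex; have [s sM sx] := square_perm j.
have : e (s w) = e w.
  apply: (@endo_ext (e \o s) e) => [c d|//|i] /=; first by rewrite sM eM.
  by rewrite sx; case: ifP => ij //; rewrite endoX // ex ij expg1n.
by rewrite sw // endoX // expgS expg1 -[RHS]mulg1 => /mulgI.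
Qed.

(** Retractions onto sets of generators compose along intersections, so an
    element may be tested for membership in the subgroup generated by a set A of
    generators by killing the generators outside A one at a time. *)
Lemma retract_fixed (A : {set 'I_n}) w :
    (forall j, j \notin A -> forall e : gT -> gT, {morph e : a b / a * b} ->
      (forall i, e (x i) = if i == j then 1 else x i) -> e w = w) ->
  forall r : gT -> gT, {morph r : a b / a * b} ->
    (forall i, r (x i) = if i \in A then x i else 1) -> r w = w.
Proof.
move=> ew.
have -> : A = \bigcap_(j in ~: A) [set~ j].
  apply/setP=> i; apply/idP/bigcapP => [Ai j | iA].
    by rewrite !inE; apply: contra => /eqP <-.
  by apply: contraT => nAi; have := iA i; rewrite !inE nAi eqxx => /(_ isT).
apply: (big_ind (fun B : {set 'I_n} => forall r : gT -> gT,
    {morph r : a b / a * b} ->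
    (forall i, r (x i) = if i \in B then x i else 1) -> r w = w))
  => [r rM rx | B C IHB IHC r rM rx | j Aj r rM rx].
- by apply: (@endo_ext r id) => // i; rewrite rx inE.
- have [b bM bx] := extend (fun i => if i \in B then x i else 1).
  have [c cM cx] := extend (fun i => if i \in C then x i else 1).
  rewrite -[RHS](IHC c) // -[in RHS](IHB b) //.
  apply: (@endo_ext r (c \o b)) => [//|f g|i] /=; first by rewrite bM cM.
  rewrite rx bx inE; case: (i \in B); last by rewrite endo1.
  by rewrite cx; case: (i \in C).
- apply: (ew j) => [|//|i]; first by rewrite inE in Aj.
  by rewrite rx !inE; case: eqP.
Qed.

Lemma retract_cyclic i (r : gT -> gT) : {morph r : a b / a * b} ->
    (forall k, r (x k) = if k \in [set i] then x k else 1) ->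
  forall a, exists k, r a = x i ^+ k.
Proof.
move=> rM rx; apply: free_ind => [|j|a b [k Da] [l Db]].
- by exists 0; rewrite endo1.
- rewrite rx inE; case: eqP => [->|_]; first by exists 1%N.
  by exists 0.
- by exists (k + l)%N; rewrite rM Da Db expgD.
Qed.

Lemma retract_two_generated i j (r : gT -> gT) : {morph r : a b / a * b} ->
    (forall k, r (x k) = if k \in [set i; j] then x k else 1) ->
  forall a, exists k l m, r a = x i ^+ k * x j ^+ l * [~ x j, x i] ^+ m.
Proof.
move=> rM rx; apply: free_ind => [|h|a b [k [l [m Da]]] [k' [l' [m' Db]]]].
- by exists 0, 0, 0; rewrite endo1 // !mulg1.
- rewrite rx !inE; case: eqP => [->|_] /=.
    by exists 1%N, 0, 0; rewrite !mulg1.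
  case: eqP => [->|_]; first by exists 0, 1%N, 0; rewrite mulg1 mul1g.
  by exists 0, 0, 0; rewrite !mulg1.
- exists (k + k')%N, (l + l')%N, (l * k' + m + m')%N.
  have zC c q : commute ([~ x j, x i] ^+ q) c.
    exact/commute_sym/commuteX/commg_central.
  rewrite rM Da Db (commute_mulgACA _ _ (zC _ _)) -addnA (expgD _ (l * k')).
  rewrite [RHS]mulgA -(expgD _ m); congr (_ * _).
  rewrite mulgA -(mulgA (x i ^+ k)) [_ ^+ l * _]commgC commXl // commXr //.
  rewrite -expgM [(k' * l)%N]mulnC -[LHS]mulgA -(mulgA (x i ^+ k' * _)).
  rewrite zC !mulgA.
  by rewrite -expgD -(mulgA _ (x j ^+ l)) -expgD.
Qed.

(** Freeness is tested against the extraspecial group of order p^3 and exponent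
    p, which belongs to the variety for p odd and is not abelian. *)
Lemma noncommuting_generators i j : i != j -> [~ x j, x i] != 1.
Proof.
move=> ij; have [_ _ universal] := freeG.
have [[Phi_eq der_eq] prZ] := pX1p2_extraspecial p_pr.
have p_odd : odd p by case: (even_prime p_pr) p_gt2 => [->|].
have varX : class2_exp_variety p (p^{1+2})%type.
  split=> [a b c | a].
    apply/eqP/commgP; have: [~ a, b] \in 'Z([set: p^{1+2}]).
      by rewrite -der_eq mem_commg ?inE.
    by case/centerP=> _ /(_ c); apply; rewrite inE.
  by apply: (exponentP (exponent_pX1p2 p_pr p_odd)); rewrite inE.
apply: contraL prZ => /eqP cij; rewrite -der_eq.
suffices /derG1P-> : abelian [set: p^{1+2}] by rewrite cards1.
apply/centsP=> a _ b _.
pose y k := if k == i then b else if k == j then a else 1.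
have [f fx] := universal _ y varX.
have fM := @gmulfM _ _ f.
have : f (x j * x i) = f (x i * x j) by rewrite commgC cij mulg1.
by rewrite !fM !fx /y !eqxx eq_sym (negPf ij).
Qed.

(** Here is where freeness bites: the automorphisms fixing x_i are so many that
    only conjugations by powers of x_i commute with all of them. *)
Lemma equivariant_inner i j (gamma : gT -> gT) : i != j ->
    injective gamma -> {morph gamma : a b / a * b} ->
    (forall s : {perm gT}, {morph s : a b / a * b} -> s (x i) = x i ->
       forall a, gamma (s a) = s (gamma a)) ->
  exists k, forall a, gamma a = a ^ (x i ^+ k).
Proof.
move=> ij gammaI gM gC.
have nz := noncommuting_generators ij; set z := [~ x j, x i] in nz.
have ntxi : x i != 1 by apply: contraNneq nz; rewrite /z => ->; rewrite commg1.
(* gamma(x_i) is fixed by each automorphism squaring another generator. *)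
have kill_gxi k : k != i -> forall e : gT -> gT, {morph e : a b / a * b} ->
    (forall l, e (x l) = if l == k then 1 else x l) ->
  e (gamma (x i)) = gamma (x i).
  move=> ki; apply: fixed_by_square => s sM sx.
  have sxi : s (x i) = x i by rewrite sx eq_sym (negPf ki).
  by rewrite -gC // sxi.
have [d gxi] : exists d, gamma (x i) = x i ^+ d.
  have [r rM rx] := extend (fun k => if k \in [set i] then x k else 1).
  have <- : r (gamma (x i)) = gamma (x i).
    by apply: (retract_fixed _ rM rx) => k; rewrite inE; apply: kill_gxi.
  exact: (retract_cyclic rM rx).
have [e eM ex] := extend (fun l => if l == j then 1 else x l).
have [q [m gxj]] : exists q m, gamma (x j) = x j ^+ q * z ^+ m.
  have [r rM rx] := extend (fun k => if k \in [set i; j] then x k else 1).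
  have rgxj : r (gamma (x j)) = gamma (x j).
    apply: (retract_fixed _ rM rx) => k; rewrite !inE negb_or => /andP[ki kj].
    apply: fixed_by_square => s sM sx.
    by rewrite -gC // sx eq_sym ?(negPf ki) ?(negPf kj).
  have [l [q [m Dxj]]] := retract_two_generated rM rx (gamma (x j)).
  rewrite rgxj in Dxj.
  (* Squaring x_j squares gamma(x_j), so x_i does not occur in it by itself. *)
  have eg1 : e (gamma (x j)) = 1.
    apply: (squared_by_square _ eM ex) => s sM sx.
    by rewrite -gC // ?sx ?eqxx ?endoX // (negPf ij).
  exists q, m; rewrite Dxj; move: eg1.
  rewrite Dxj 2!eM !(endoX eM) (endoR eM) !ex eqxx (negPf ij).
  by rewrite comm1g !expg1n !mulg1 => ->; rewrite mul1g.
(* Compare the transvection x_j |-> x_j x_i with gamma, modulo x_j. *)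
have db : x i ^+ d = x i ^+ q.
  have [s sM sx] := transvection_perm ij.
  have := gC s sM _ (x j); rewrite !sx eqxx (negPf ij) => /(_ erefl).
  rewrite gM gxi gxj sM !(endoX sM) (endoR sM) !sx eqxx (negPf ij).
  move/(congr1 e); rewrite 3!eM !(endoX eM) !(endoR eM) eM !ex eqxx (negPf ij).
  by rewrite !(mul1g, mulg1, comm1g, expg1n, commgg).
have d_eq : d = q %[mod p].
  by apply/eqP; rewrite -(order_exp_p p_pr varG ntxi) -eq_expg_mod_order db.
(* Compare conjugation by x_i with gamma: z^(q d) = z^q. *)
have qd : q * d = q %[mod p].
  apply/eqP; rewrite -(order_exp_p p_pr varG nz) -eq_expg_mod_order.
  have wR c : [~ gamma (x j), c] = [~ x j, c] ^+ q.
    by rewrite gxj commgMl // commXl // commXl // class2 expg1n mulg1.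
  have JM : {morph perm (conjg_inj (x i)) : a b / a * b}.
    by move=> a b; rewrite !permE conjMg.
  have := gC _ JM _ (x j); rewrite !permE endoJ // gxi !conjg_mulR.
  rewrite commgg mulg1 => /(_ erefl)/mulgI.
  by rewrite commXr // wR -/z -expgM => ->.
have p_ndv_d : ~~ (p %| d).
  apply: contra ntxi => p_dv_d; rewrite -(inj_eq gammaI) endo1 // gxi.
  by rewrite -(expg_modp varG) (eqP p_dv_d).
have d1 : d = 1 %[mod p].
  have d_gt0 : 0 < d by rewrite lt0n; apply: contraNneq p_ndv_d => ->.
  move/eqP: qd; rewrite eqn_mod_dvd ?leq_pmulr // -[X in _ - X]muln1 -mulnBr.
  have p_ndv_q : (p %| q) = false by rewrite /dvdn -d_eq; apply/negbTE.
  by rewrite Euclid_dvdM // p_ndv_q -eqn_mod_dvd // => /eqP.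
exists m; apply: endo_ext => [//|f g|k]; first by rewrite conjMg.
have [->|ki] := eqVneq k i.
  rewrite gxi -(expg_modp varG) d1 (expg_modp varG) expg1.
  by rewrite conjgE (commuteX m (commute_refl _)) mulKg.
have gxj_inner : gamma (x j) = x j ^ (x i ^+ m).
  rewrite gxj conjgX_class2 // -(expg_modp varG) -d_eq d1 (expg_modp varG).
  by rewrite expg1.
(* The other generators are reached by swapping them with x_j. *)
have [s sM sx] := swap_perm j k.
have sxi : s (x i) = x i by rewrite sx tpermD // eq_sym.
have -> : x k = s (x j) by rewrite sx tpermL.
by rewrite gC // gxj_inner endoJ // endoX // sxi.
Qed.

(** On the set S of the g with gamma(g) the conjugation by g^k, the twisted
    product gamma(h)(g) h is g h [g, h]^k.  To see that S is closed under the
    product of G, one must get rid of the last factor, and so show that S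
    contains the commutators [g, b] for g in S: such a commutator is the twisted
    product of g^-1 and the conjugate g^b, which lies in S by equivariance. *)
Lemma equivariant_family_inner (gamma : gT -> {perm gT}) : 1 < n ->
    (forall g, {morph gamma g : a b / a * b}) ->
    (forall (s : {perm gT}) g, {morph s : a b / a * b} ->
       gamma (s g) = gamma g ^ s) ->
    (forall g h, gamma (gamma h g * h) = gamma g * gamma h) ->
  exists k, forall g a, gamma g a = a ^ (g ^+ k).
Proof.
move=> n_gt1 gM gJ gammaM.
pose i : 'I_n := Ordinal (ltnW n_gt1); pose j : 'I_n := Ordinal n_gt1.
have gC (s : {perm gT}) : {morph s : a b / a * b} -> s (x i) = x i ->
    forall a, gamma (x i) (s a) = s (gamma (x i) a).
  by move=> sM sx a; rewrite -[in LHS]sx gJ // permJ.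
have [k inner_i] := equivariant_inner (isT : i != j) (@perm_inj _ _) (gM _) gC.
exists k.
pose S g := forall a, gamma g a = a ^ (g ^+ k).
have S_auto (s : {perm gT}) g : {morph s : a b / a * b} -> S g -> S (s g).
  move=> sM Sg a; rewrite gJ // -{1}(permKV s a) permJ Sg endoJ // endoX //.
  by rewrite permKV.
have S_twist g h : S g -> S h -> S (g * h * [~ g, h] ^+ k).
  move=> Sg Sh a; have Dgh : gamma h g * h = g * h * [~ g, h] ^+ k.
    rewrite Sh conjgX_class2 // -!mulgA; congr (_ * _).
    exact/commute_sym/commuteX/commg_central.
  rewrite -[in LHS]Dgh gammaM permM Sg Sh -conjgM conjgX_class2 // conjg_mulR.
  rewrite !commgMr // !commXr // commRr // expg1n mulg1.
  by congr (_ * _); rewrite [RHS]expgMn; last exact: commg_central.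
have gamma1 : gamma 1 = 1.
  by apply: (mulIg (gamma 1)); rewrite -gammaM (endo1 (gM _)) !mul1g.
have S1 : S 1 by move=> a; rewrite gamma1 perm1 expg1n conjg1.
have SV g : S g -> S g^-1.
  move=> Sg a; have := gammaM g^-1 g.
  rewrite Sg conjVg conjgE (commuteX k (commute_refl g)) mulKg mulVg gamma1.
  move/permP/(_ a); rewrite perm1 permM Sg => {2}->.
  by rewrite expgVn conjgK.
have S_comm g b : S g -> S [~ g, b].
  move=> Sg; have JM : {morph perm (conjg_inj b) : c d / c * d}.
    by move=> c d; rewrite !permE conjMg.
  have := S_twist _ _ (SV _ Sg) (S_auto _ _ JM Sg); rewrite permE.
  rewrite conjg_mulR commgMr // commRr // mulKg mulg1.
  rewrite -[[~ g^-1, g]]invgR commgVg.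
  by rewrite invg1 expg1n mulg1.
have SM g h : S g -> S h -> S (g * h).
  move=> Sg Sh; have := S_twist _ _ (S_twist _ _ Sg Sh) (S_comm g (h ^- k) Sg).
  rewrite commRr // expg1n mulg1 commgV; last exact: commg_central.
  by rewrite commXr // mulgK.
apply: free_ind => // l.
have [s sM sx] := swap_perm i l.
by have := S_auto s _ sM inner_i; rewrite sx tpermL.
Qed.

(** The transported group law is (g, h) |-> g h [g, h]^k, and the power 2k+1
    turns it back into the law of G. *)
Lemma NHol_power_morph (t : {perm gT}) : 1 < n -> t \in NHol gT -> t 1 = 1 ->
  exists u : {unit 'Z_p}, {morph (fun g => t g ^+ val u) : g h / g * h}.
Proof.
move=> n_gt1 tN t1.
have [gamma [gM gJ gammaM tM]] := twisted_translations tN t1.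
have [k gammaE] := equivariant_family_inner n_gt1 gM gJ gammaM.
have {gammaE gM gJ gammaM}tM a b : t (a * b) = t a * t b * [~ t a, t b] ^+ k.
  rewrite tM gammaE conjgX_class2 // -!mulgA; congr (_ * _).
  exact/commute_sym/commuteX/commg_central.
(* Otherwise the transported law would be commutative. *)
have p_ndv : ~~ (p %| (k.*2).+1).
  have := noncommuting_generators (isT : Ordinal (ltnW n_gt1) != Ordinal n_gt1).
  apply: contra => p_dv; set b := x (Ordinal n_gt1); set a := x _.
  apply/commgP/(@perm_inj _ t); rewrite !tM [t b * t a]commgC -[LHS]mulgA.
  congr (_ * _); apply/eqP; rewrite -expgS -[[~ t a, t b]]invgR expgVn.
  by rewrite -mulg_eq1 -expgD addSn addnn -(expg_modp varG) (eqP p_dv).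
have u_unit : ((k.*2.+1)%:R : 'Z_p)%R \is a GRing.unit.
  by rewrite unitZpE ?prime_gt1 // prime_coprime.
exists (FinRing.unit 'Z_p u_unit) => /= a b.
rewrite val_Zp_nat ?prime_gt1 // !(expg_modp varG) tM.
rewrite expgMn; last exact/commuteX/commg_central.
rewrite expMg_class2 // -[[~ t b, t a]]invgR expgVn -expgM.
have -> : 'C((k.*2).+1, 2) = (k * (k.*2).+1)%N.
  by rewrite bin2 /= -doubleMr doubleK mulnC.
by rewrite mulgVK.
Qed.

End FreeGroup.

Theorem theorem5p2 (p n : nat) (p_prime : prime p) (p_gt2 : 2 < p)
    (n_ge2 : 2 <= n) (gT : finGroupType) (freeG : free_class2_exp p n gT) :
  cyclic (THol gT) /\ #|THol gT| = p.-1.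
Proof.
have [x freeG_x] := freeG; have [varG _ _] := freeG_x.
have nc := @noncommuting_generators _ _ _ _ p_prime p_gt2 freeG_x
  (Ordinal (ltnW n_ge2)) (Ordinal n_ge2) isT.
apply: (THol_cyclic_card p_prime varG nc) => t tN t1.
exact: (NHol_power_morph p_prime p_gt2 freeG_x).
Qed.
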